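(* For every positive integer $b$, as $n\to\infty$, \[ \chi\bigl( G_b(n)\bigr)\le \bigl( 2^{(b-1)^2}+o(1)\bigr)\log_{(b-1)}(n)\,. \]
   Context: For positive integers $b,n$, let $V_b(n)$ be the set of tuples $(x_1,\dots,x_{2b-1})$ of integers with $1\le x_1\le x_2\le\dots\le x_{2b-1}\le n$ and $x_1<x_3<\dots<x_{2b-1}$. $G_b(n)$ is the graph on $V_b(n)$ in which $\{\mathbf{x},\mathbf{y}\}$ is an edge iff one can write $\mathbf{x}=(x_1,\dots,x_{2b-1})$, $\mathbf{y}=(y_1,\dots,y_{2b-1})$ (in some order of the two vertices) with (i) $x_1<y_1\le x_3<y_3\le\dots\le x_{2b-1}<y_{2b-1}$ and (ii) $x_{j+1}\le y_j$ for all $j\in[2b-2]$. $\log_{(t)}$ is the $t$-fold iterated base-$2$ logarithm, with $\log_{(0)}(n)=n$. *)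

(* Defs.v *)
From HB Require Import structures.
From mathcomp Require Import all_boot all_order all_algebra.
From mathcomp Require Import all_classical all_reals all_analysis.

Set Implicit Arguments.
Unset Strict Implicit.
Unset Printing Implicit Defensive.

Import Order.TTheory GRing.Theory Num.Theory.
Import numFieldNormedType.Exports.

Record sgraph := SGraph {
  vertex :> finType;
  edge : rel vertex;
  edge_sym : symmetric edge;
  edge_irrefl : irreflexive edge }.

Section ChromaticNumber.
Variable G : sgraph.

Definition colorable (k : nat) : bool :=
  [exists c : {ffun G -> 'I_k}, forall x, forall y, edge x y ==> (c x != c y)].

Lemma colorable_card : exists k, colorable k.
Proof.
exists #|G|; apply/existsP; exists [ffun x => enum_rank x].
apply/forallP => x; apply/forallP => y; apply/implyP => exy.
rewrite !ffunE (inj_eq enum_rank_inj); apply/eqP => xy.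
by rewrite xy edge_irrefl in exy.
Qed.

Definition chromatic_number : nat := ex_minn colorable_card.

End ChromaticNumber.

Section GraphG.
Variables b n : nat.

(* Entries lie in {0, ..., n}; 0 is excluded by [in_V]. *)
Local Notation tup := ((2 * b - 1).-tuple 'I_n.+1).

(* One-based indexing: [coord x j] is x_j for 1 <= j <= 2b-1. *)
Definition coord (x : tup) (j : nat) : nat := nth ord0 x j.-1.

(* [index_iota l u] enumerates the j with l <= j < u, so that odd positions
   are 2i-1 for i in [index_iota 1 b.+1]. *)
Definition in_V (x : tup) : bool :=
  [&& 1 <= coord x 1,
      all (fun j => coord x j <= coord x j.+1) (index_iota 1 (2 * b - 1))
    & all (fun i => coord x (2 * i - 1) < coord x (2 * i + 1))
          (index_iota 1 b)].

Definition V : finType := {x : tup | in_V x}.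

Definition arc (u v : V) : bool :=
  let x := coord (val u) in let y := coord (val v) in
  [&& all (fun i => x (2 * i - 1) < y (2 * i - 1)) (index_iota 1 b.+1),
      all (fun i => y (2 * i - 1) <= x (2 * i + 1)) (index_iota 1 b)
    & all (fun j => x j.+1 <= y j) (index_iota 1 (2 * b - 1))].

(* The disequality matters only for the degenerate value b = 0. *)
Definition G_edge (u v : V) : bool := (u != v) && (arc u v || arc v u).

Lemma G_edge_sym : symmetric G_edge.
Proof. by move=> u v; rewrite /G_edge eq_sym orbC. Qed.

Lemma G_edge_irrefl : irreflexive G_edge.
Proof. by move=> u; rewrite /G_edge eqxx. Qed.

Definition G : sgraph := SGraph G_edge_sym G_edge_irrefl.

End GraphG.

Local Open Scope ring_scope.

Definition log2 (R : realType) (x : R) : R := ln x / ln 2.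

Definition iter_log2 (R : realType) (t : nat) (x : R) : R := iter t (@log2 R) x.

(* Main.v *)
Require Import Defs.
From HB Require Import structures.
From mathcomp Require Import all_boot all_order all_algebra.
From mathcomp Require Import all_classical all_reals all_analysis.
From mathcomp Require Import zify lra.

(* Let the level of an interval ]u, v] be 1 plus the largest 2-adic valuation
   of its elements; the maximum is attained only once, so two adjacent
   intervals never have the same nonzero level.  Send x = (x_1, ..., x_{2b-1})
   to z = (d_1, e_1, d_2, ..., e_{b-2}, d_{b-1}), where d_i is the level of
   ]x_{2i-1}, x_{2i+1}] and e_i is that of ]x_{2i}, x_{2i+2}], raised to
   min(d_i, d_{i+1}) if it is smaller.  If x -> y is an arc, and x and y agree on
   which side of x_{2i} the level d_i is attained, on the sign of d_{i+1} - d_i,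
   and on whether e_i equals d_i or d_{i+1}, then this sign does not depend on i,
   and the images of x and y form an arc of G_{b-1}(N) with N about log2 n, once
   every value v is replaced by N + 1 - v in case the d_i decrease.  The x whose
   d_i are not monotone can therefore be coloured by the recorded bits alone, and
   cost O(1) colours.  For the others these bits are redundant: whether e_1 is
   strictly between d_1 and d_2, together with the colour of z, determines one of
   the side bits, provided that the colouring of G_{b-1}(N) separates e_1 = d_1
   from e_1 = d_2.  There remain 1 sign bit, b - 2 side bits and b - 2 bits for
   the e_i, that is 2b - 3 bits per step, and 1 + 3 + ... + (2b-3) = (b-1)^2. *)

Set Implicit Arguments.
Unset Strict Implicit.
Unset Printing Implicit Defensive.

(** * Levels *)

(** Adding 1 to the valuation reserves level 0 for the empty interval. *)
Definition ruler (u v : nat) : nat := \max_(u.+1 <= m < v.+1) (logn 2 m).+1.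

Lemma ruler_cat u v w : u <= v <= w ->
  ruler u w = maxn (ruler u v) (ruler v w).
Proof. by case/andP=> uv vw; rewrite /ruler (@big_cat_nat _ _ _ v.+1). Qed.

Lemma ruler_nn u : ruler u u = 0.
Proof. by rewrite /ruler big_geq. Qed.

Lemma ruler_recr u v : u <= v ->
  ruler u v.+1 = maxn (ruler u v) (logn 2 v.+1).+1.
Proof. by move=> uv; rewrite /ruler big_nat_recr. Qed.

Lemma ruler_ge u v m : u < m <= v -> (logn 2 m).+1 <= ruler u v.
Proof.
move=> /andP[um mv]; rewrite (@ruler_cat u m v) ?mv ?(ltnW um) //.
case: m um mv => // m um mv.
by rewrite ruler_recr // leq_max leq_max leqnn orbT.
Qed.

Lemma ruler_gt0 u v : u < v -> 0 < ruler u v.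
Proof. by move=> uv; apply: leq_trans (@ruler_ge u v v _); rewrite ?uv /=. Qed.

Lemma ruler_wit u v : 0 < ruler u v ->
  exists2 m, u < m <= v & ruler u v = (logn 2 m).+1.
Proof.
have [vu|uv] := leqP v u; first by rewrite /ruler big_geq.
move: uv; elim: v => // v IH uv _.
rewrite ruler_recr //; case: (leqP (ruler u v) (logn 2 v.+1).+1) => h.
  by exists v.+1 => //; rewrite uv /=.
have uv' : u < v.
  by rewrite ltnNge; apply/negP => vu; move: h; rewrite /ruler big_geq.
have [m /andP[um mv] mE] := IH uv' (leq_ltn_trans (leq0n _) h).
by exists m => //; rewrite um ltnW.
Qed.

(** Write the two numbers as [a * 2 ^ k] and [c * 2 ^ k] with [a < c] odd; then [a.+1] is even and
    smaller than [c], so [a.+1 * 2 ^ k] is a witness. *)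
Lemma logn2_between m1 m2 : 0 < m1 < m2 -> logn 2 m1 = logn 2 m2 ->
  exists2 m, m1 < m < m2 & logn 2 m1 < logn 2 m.
Proof.
case/andP=> m1_gt0 m12 eq12; have m2_gt0 := ltn_trans m1_gt0 m12.
have [a a2 m1E] := pfactor_coprime (isT : prime 2) m1_gt0.
have [c c2 m2E] := pfactor_coprime (isT : prime 2) m2_gt0.
move: m2E; rewrite -eq12; set k := logn 2 m1 in m1E * => m2E.
rewrite coprime2n in a2; rewrite coprime2n in c2.
have k0 : 0 < 2 ^ k by rewrite expn_gt0.
have ac : a < c by rewrite -(ltn_pmul2r k0) -m1E -m2E.
have ac' : a.+1 < c.
  by rewrite ltn_neqAle ac andbT; apply: contraTneq c2 => <-; rewrite /= a2.
exists (a.+1 * 2 ^ k); first by rewrite m1E m2E !ltn_pmul2r // ltnSn.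
rewrite lognM // pfactorK // -[X in X < _]add0n ltn_add2r.
by rewrite logn_gt0 mem_primes /= dvdn2 /= a2.
Qed.

(** An equal nonzero level would be attained at some [m1 <= v < m2] of equal valuation. A number of
    larger valuation between them lies in one of the two intervals and exceeds the common level. *)
Lemma ruler_adjacent u v w : u <= v <= w -> ruler u v = ruler v w ->
  ruler u v = 0.
Proof.
move=> uvw eqr; apply/eqP; rewrite -leqn0 leqNgt; apply/negP => uv0.
have vw0 : 0 < ruler v w by rewrite -eqr.
have [m1 /andP[um1 m1v] m1E] := ruler_wit uv0.
have [m2 /andP[vm2 m2w] m2E] := ruler_wit vw0.
have [||m /andP[m1m mm2] lt] := @logn2_between m1 m2.
- by rewrite (leq_ltn_trans _ um1) //= (leq_ltn_trans m1v).
- by apply: succn_inj; rewrite -m1E -m2E.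
have : (logn 2 m).+1 <= ruler u v.
  have [mv|vm] := leqP m v; first by apply: ruler_ge; rewrite mv andbT (ltn_trans um1).
  by rewrite eqr; apply: ruler_ge; rewrite vm (leq_trans (ltnW mm2)).
by rewrite m1E ltnS leqNgt lt.
Qed.

Lemma ruler_le u v : ruler u v <= (trunc_log 2 v).+1.
Proof.
have [->//|/ruler_wit[m /andP[um mv] ->]] := posnP (ruler u v).
have m0 : 0 < m by apply: leq_ltn_trans um.
rewrite ltnS; apply: trunc_log_max => //; apply: leq_trans mv.
by apply: dvdn_leq => //; rewrite pfactor_dvdnn.
Qed.

(* s1..s4 (t1..t4) are the levels of four consecutive intervals delimited by
   x_1 <= ... <= x_5 (by y_1 <= ... <= y_5).  If d_1 < d_2 then
   e_1 = max(s3, d_1), and the conclusion says that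
   (d_1, e_1, d_2) -> (d'_1, e'_1, d'_2) is an arc. *)
Definition forward (s1 s2 s3 s4 t1 t2 t3 t4 : nat) := forall b1 b2 : bool,
  (if b1 then s2 < s1 /\ t2 < t1 else s1 < s2 /\ t1 < t2) ->
  (if b2 then s4 < s3 /\ t4 < t3 else s3 < s4 /\ t3 < t4) ->
  maxn s1 s2 < maxn s3 s4 -> maxn t1 t2 < maxn t3 t4 ->
  (s3 <= maxn s1 s2) = (t3 <= maxn t1 t2) ->
  [/\ maxn s1 s2 < maxn t1 t2, maxn t1 t2 <= maxn s3 s4,
      maxn s3 s4 < maxn t3 t4, s3 <= maxn t1 t2
    & maxn s3 s4 <= maxn t3 (maxn t1 t2)].

(* The l_i are the levels of the nine intervals cut out by
   x_1 <= x_2 <= y_1 <= x_3 <= y_2 <= x_4 <= y_3 <= x_5 <= y_4 <= y_5. *)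
Lemma forward_left l1 l2 l3 l4 l5 l6 l7 l8 l9 :
  forward l1 (maxn l2 l3) (maxn l4 l5) (maxn l6 l7)
          (maxn l3 l4) (maxn l5 l6) (maxn l7 l8) l9.
Proof.
case; case=> -[h1 h3] [h2 h4];
  rewrite ?(maxn_idPr (ltnW h1)) ?(maxn_idPl (ltnW h1))
    ?(maxn_idPr (ltnW h2)) ?(maxn_idPl (ltnW h2)) ?(maxn_idPr (ltnW h3))
    ?(maxn_idPl (ltnW h3)) ?(maxn_idPr (ltnW h4)) ?(maxn_idPl (ltnW h4))
    => h5 h6 h7; split; lia.
Qed.

(* The same for x_4 <= y_2. *)
Lemma forward_right l1 l2 l3 l4 l5 l6 l7 l8 l9 :
  forward l1 (maxn l2 l3) l4 (maxn l5 (maxn l6 l7))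
          (maxn l3 (maxn l4 l5)) l6 (maxn l7 l8) l9.
Proof.
case; case=> -[h1 h3] [h2 h4];
  rewrite ?(maxn_idPr (ltnW h1)) ?(maxn_idPl (ltnW h1))
    ?(maxn_idPr (ltnW h2)) ?(maxn_idPl (ltnW h2)) ?(maxn_idPr (ltnW h3))
    ?(maxn_idPl (ltnW h3)) ?(maxn_idPr (ltnW h4)) ?(maxn_idPl (ltnW h4))
    => h5 h6 h7; split; lia.
Qed.

(* Negating all points exchanges x and y, and increasing with decreasing levels. *)
Lemma forward_left_rev l1 l2 l3 l4 l5 l6 l7 l8 l9 :
  forward l9 (maxn l7 l8) (maxn l5 l6) (maxn l3 l4)
          (maxn l6 l7) (maxn l4 l5) (maxn l2 l3) l1.
Proof.
rewrite (maxnC l7 l8) (maxnC l5 l6) (maxnC l3 l4) (maxnC l6 l7) (maxnC l4 l5).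
by rewrite (maxnC l2 l3); apply: forward_left.
Qed.

Lemma forward_right_rev l1 l2 l3 l4 l5 l6 l7 l8 l9 :
  forward l9 (maxn l7 l8) l6 (maxn l3 (maxn l4 l5))
          (maxn l5 (maxn l6 l7)) l4 (maxn l2 l3) l1.
Proof.
have maxnCA a b c : maxn a (maxn b c) = maxn c (maxn b a).
  by rewrite maxnC (maxnC b) -maxnA.
by rewrite (maxnC l7 l8) (maxnC l2 l3) (maxnCA l3) (maxnCA l5 l6); apply: forward_right.
Qed.

(** This is e_1 in terms of the levels of four consecutive segments: the middle interval consists of
    the second and the third. *)
Definition clamp_mid (s1 s2 s3 s4 : nat) :=
  maxn (maxn s2 s3) (minn (maxn s1 s2) (maxn s3 s4)).

Lemma forward_clamp (s1 s2 s3 s4 t1 t2 t3 t4 : nat) :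
  forward s1 s2 s3 s4 t1 t2 t3 t4 ->
  let d1 := maxn s1 s2 in let d2 := maxn s3 s4 in
  let d1' := maxn t1 t2 in let d2' := maxn t3 t4 in
  let e := clamp_mid s1 s2 s3 s4 in
  let e' := clamp_mid t1 t2 t3 t4 in
  s1 != s2 -> s3 != s4 -> t1 != t2 -> t3 != t4 ->
  (s2 < s1) = (t2 < t1) -> (s4 < s3) = (t4 < t3) ->
  d1 < d2 -> d1' < d2' -> (e == d1) = (e' == d1') ->
  [/\ d1 < d1', d1' <= d2, d2 < d2', e <= d1' & d2 <= e'].
Proof.
move=> fw d1 d2 d1' d2' e e' n1 n2 n3 n4 b1 b2 lt lt'.
(* As [s2 <= d1 < d2], only [s3] can lift [e] above [d1]; thus [e == d1] encodes the test [s3 <= d1]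
   of [forward]. *)
have eE : e = maxn s3 d1 by rewrite /e /clamp_mid; lia.
have eE' : e' = maxn t3 d1' by rewrite /e' /clamp_mid; lia.
have maxn_eqr m n : (maxn m n == n) = (m <= n) by lia.
rewrite eE eE' !maxn_eqr => h.
have [h1 h2 h3 h4 h5] : [/\ d1 < d1', d1' <= d2, d2 < d2', s3 <= d1' & d2 <= maxn t3 d1'].
  by apply: (fw (s2 < s1) (s4 < s3)) => //; case: ifP => ?; split; lia.
by split=> //; rewrite geq_max h4 ltnW.
Qed.

(** * Levels of a vertex *)

Implicit Types (x y : nat -> nat) (i j k n : nat).

(* A vertex of G_b(n) is represented by a sequence indexed from 0, with
   k = b - 1, so that x_j of the paper is [x j.-1]. *)
Definition is_vertex k n x : Prop :=
  [/\ 0 < x 0, x k.*2 <= n, forall j, j < k.*2 -> x j <= x j.+1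
    & forall i, i < k -> x i.*2 < x i.*2.+2].

Definition is_arc k x y : Prop :=
  [/\ forall i, i <= k -> x i.*2 < y i.*2,
      forall i, i < k -> y i.*2 <= x i.*2.+2
    & forall j, j < k.*2 -> x j.+1 <= y j].

Definition seg_level x j := ruler (x j) (x j.+1).

Definition gap_level x i := ruler (x i.*2) (x i.*2.+2).

Definition mid_level x i :=
  maxn (ruler (x i.*2.+1) (x i.*2.+3)) (minn (gap_level x i) (gap_level x i.+1)).

Definition left_heavy x i := seg_level x i.*2.+1 < seg_level x i.*2.

Definition ascending x i := gap_level x i < gap_level x i.+1.

Definition mid_left x i := mid_level x i == gap_level x i.

Definition mid_right x i := mid_level x i == gap_level x i.+1.

Lemma vertex_mono k n x j1 j2 : is_vertex k n x ->
  j1 <= j2 -> j2 <= k.*2 -> x j1 <= x j2.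
Proof.
case=> _ _ mono _; elim: j2 => [|j IH]; first by rewrite leqn0 => /eqP->.
rewrite leq_eqVlt => /predU1P[->//|j1j] jk.
by apply: leq_trans (mono _ jk); apply: IH => //; apply: ltnW.
Qed.

Lemma vertex_le k n x j : is_vertex k n x -> j <= k.*2 -> x j <= n.
Proof. by move=> vx jk; have [_ + _ _] := vx; apply: leq_trans (vertex_mono vx jk _). Qed.

Section Vertex.
Variables (k n : nat) (x : nat -> nat).
Hypothesis vx : is_vertex k n x.

Lemma gap_levelE i : i < k ->
  gap_level x i = maxn (seg_level x i.*2) (seg_level x i.*2.+1).
Proof.
by move=> ik; apply: ruler_cat; apply/andP; split; apply: (vertex_mono vx); lia.
Qed.

Lemma mid_levelE i : i.+1 < k ->
  mid_level x i = clamp_mid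
    (seg_level x i.*2) (seg_level x i.*2.+1)
    (seg_level x i.*2.+2) (seg_level x i.*2.+3).
Proof.
move=> ik; rewrite /mid_level /clamp_mid !gap_levelE ?doubleS //; last exact: ltnW.
congr maxn; apply: ruler_cat.
by apply/andP; split; apply: (vertex_mono vx); lia.
Qed.

Lemma gap_level_gt0 i : i < k -> 0 < gap_level x i.
Proof. by move=> ik; apply: ruler_gt0; case: vx => _ _ _; apply. Qed.

Lemma gap_level_le i : i < k -> gap_level x i <= (trunc_log 2 n).+1.
Proof.
move=> ik; apply: leq_trans (ruler_le _ _) _; rewrite ltnS.
by apply: leq_trunc_log; apply: (vertex_le vx); lia.
Qed.

Lemma seg_level_neq i : i < k -> seg_level x i.*2 != seg_level x i.*2.+1.
Proof.
move=> ik; apply/eqP => eqs; have := gap_level_gt0 ik.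
rewrite gap_levelE // -eqs maxnn /seg_level (@ruler_adjacent _ _ (x i.*2.+2)) //.
by apply/andP; split; apply: (vertex_mono vx); lia.
Qed.

Lemma gap_level_neq i : i.+1 < k -> gap_level x i != gap_level x i.+1.
Proof.
move=> ik; apply/eqP => eqd; have := gap_level_gt0 (ltnW ik).
rewrite /gap_level (@ruler_adjacent _ _ (x i.*2.+4)) //.
by apply/andP; split; apply: (vertex_mono vx); lia.
Qed.

Lemma mid_level_bounds i : i.+1 < k ->
  minn (gap_level x i) (gap_level x i.+1) <= mid_level x i
    <= maxn (gap_level x i) (gap_level x i.+1).
Proof.
move=> ik; rewrite mid_levelE // !gap_levelE ?doubleS //; last exact: ltnW.
by rewrite /clamp_mid; lia.
Qed.

(** The middle level can reach the larger gap level only through the segment shared with that gap: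
    here the left half of gap [i.+1], and in [mid_leftE] the right half of gap [i]. *)
Lemma mid_rightE i : i.+1 < k -> ascending x i -> mid_right x i = left_heavy x i.+1.
Proof.
move=> ik; have := seg_level_neq ik; rewrite /ascending /mid_right /left_heavy.
rewrite mid_levelE // !gap_levelE ?doubleS //; last exact: ltnW.
by rewrite /clamp_mid; lia.
Qed.

Lemma mid_leftE i : i.+1 < k -> ~~ ascending x i -> mid_left x i = ~~ left_heavy x i.
Proof.
move=> ik; have := gap_level_neq ik; have := seg_level_neq (ltnW ik).
rewrite /ascending /mid_left /left_heavy.
rewrite mid_levelE // !gap_levelE ?doubleS //; last exact: ltnW.
by rewrite /clamp_mid; lia.
Qed.

Lemma mid_leftN_right i : i.+1 < k -> mid_left x i -> mid_right x i = false.
Proof.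
by move=> ik /eqP eL; apply/negbTE; rewrite /mid_right eL gap_level_neq.
Qed.

End Vertex.

Lemma ruler_forward (x1 x2 x3 x4 x5 y1 y2 y3 y4 y5 : nat) :
  x1 <= x2 <= y1 -> y1 <= x3 -> x3 <= x4 <= y3 -> x3 <= y2 <= y3 ->
  y3 <= x5 <= y4 -> y4 <= y5 ->
  forward (ruler x1 x2) (ruler x2 x3) (ruler x3 x4) (ruler x4 x5)
          (ruler y1 y2) (ruler y2 y3) (ruler y3 y4) (ruler y4 y5) /\
  forward (ruler y4 y5) (ruler y3 y4) (ruler y2 y3) (ruler y1 y2)
          (ruler x4 x5) (ruler x3 x4) (ruler x2 x3) (ruler x1 x2).
Proof.
move=> /andP[x12 x2y1] y1x3 /andP[x34 x4y3] /andP[x3y2 y23] /andP[y3x5 x5y4] y45.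
rewrite (@ruler_cat x2 y1 x3) ?x2y1 // (@ruler_cat y3 x5 y4) ?y3x5 //.
(* The order of [x4] and [y2] is the only one that the hypotheses leave open. *)
have [yx|xy] := leqP y2 x4.
  rewrite (@ruler_cat x3 y2 x4) ?x3y2 // (@ruler_cat y2 x4 y3) ?yx //.
  rewrite (@ruler_cat x4 y3 x5) ?x4y3 // (@ruler_cat y1 x3 y2) ?y1x3 //.
  by split; [apply: forward_left|apply: forward_left_rev].
have {}xy := ltnW xy.
rewrite (@ruler_cat x4 y3 x5) ?x4y3 // (@ruler_cat x4 y2 y3) ?xy //.
rewrite (@ruler_cat y1 x3 y2) ?y1x3 // (@ruler_cat x3 x4 y2) ?x34 //.
rewrite -(maxnA _ _ (ruler y3 x5)).
by split; [apply: forward_right|apply: forward_right_rev].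
Qed.

Lemma clamp_mid_rev s1 s2 s3 s4 : clamp_mid s4 s3 s2 s1 = clamp_mid s1 s2 s3 s4.
Proof. by rewrite /clamp_mid; lia. Qed.

Lemma arc_levels k n x y i : is_vertex k n x -> is_vertex k n y ->
  is_arc k x y -> i.+1 < k ->
  left_heavy x i = left_heavy y i -> left_heavy x i.+1 = left_heavy y i.+1 ->
  ascending x i = ascending y i ->
  mid_left x i = mid_left y i -> mid_right x i = mid_right y i ->
  if ascending x i then
    [/\ gap_level x i < gap_level y i, gap_level y i <= gap_level x i.+1,
        gap_level x i.+1 < gap_level y i.+1, mid_level x i <= gap_level y i
      & gap_level x i.+1 <= mid_level y i]
  else
    [/\ gap_level y i < gap_level x i, gap_level x i.+1 <= gap_level y i,
        gap_level y i.+1 < gap_level x i.+1, gap_level y i <= mid_level x i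
      & mid_level y i <= gap_level x i.+1].
Proof.
move=> vx vy [axy ayx ajj] ik.
have ik' := ltnW ik.
have hx j : j < k.*2 -> x j <= x j.+1 by move=> jk; apply: (vertex_mono vx).
have hy j : j < k.*2 -> y j <= y j.+1 by move=> jk; apply: (vertex_mono vy).
have [||||||fw fw'] := @ruler_forward (x i.*2) (x i.*2.+1) (x i.*2.+2)
  (x i.*2.+3) (x i.*2.+4) (y i.*2) (y i.*2.+1) (y i.*2.+2) (y i.*2.+3) (y i.*2.+4).
- by rewrite hx ?ajj //; lia.
- by apply: ayx.
- by rewrite hx ?ajj //; lia.
- by rewrite hy ?andbT ?ajj //; lia.
- apply/andP; split; first exact: (ayx i.+1 ik).
  by apply: ajj; lia.
- by apply: hy; lia.
have := seg_level_neq vx ik'; have := seg_level_neq vx ik.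
have := seg_level_neq vy ik'; have := seg_level_neq vy ik.
have := gap_level_neq vx ik; have := gap_level_neq vy ik.
rewrite /ascending /mid_left /mid_right /left_heavy.
rewrite !(mid_levelE vx) ?(mid_levelE vy) // !(gap_levelE vx) // !(gap_levelE vy) //.
rewrite ?doubleS /seg_level.
move=> ny nx n1 n2 n3 n4 b1 b2 up eL eR.
case: ifP => upx; first by apply: (forward_clamp fw) => //; rewrite -up.
move/negbT: (upx); rewrite -leqNgt leq_eqVlt eq_sym (negPf nx) /= => dn.
move/negbT: (upx); rewrite up -leqNgt leq_eqVlt eq_sym (negPf ny) /= => dn'.
(* For descending levels the points are read from right to left: [x] and [y] trade places, and
   [mid_right] takes over the role of [mid_left]. *)
have [] := forward_clamp fw'.
1-4: by rewrite eq_sym.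
1,2: by clear -b1 b2 n1 n2 n3 n4; lia.
1,2: by rewrite maxnC [X in _ < X]maxnC.
1: by rewrite (clamp_mid_rev (ruler (y i.*2) _)) (clamp_mid_rev (ruler (x i.*2) _))
  (maxnC (ruler (y i.*2.+3) _))
     (maxnC (ruler (x i.*2.+3) _)) eR.
rewrite (clamp_mid_rev (ruler (y i.*2) _)) (clamp_mid_rev (ruler (x i.*2) _))
  (maxnC (ruler (y i.*2.+3) _)) (maxnC (ruler (x i.*2.+3) _)).
rewrite (maxnC (ruler (y i.*2.+1) _)) (maxnC (ruler (x i.*2.+1) _)).
by move=> *; split.
Qed.

(** * Reduction of the number of gaps *)

Definition levels (N : nat) (up : bool) x j :=
  let v := if odd j then mid_level x j./2 else gap_level x j./2 in
  if up then v else N.+1 - v.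

Definition monotone_levels k (up : bool) x := forall i, i < k -> ascending x i = up.

Lemma levels_even N up x i :
  levels N up x i.*2 = if up then gap_level x i else N.+1 - gap_level x i.
Proof. by rewrite /levels odd_double doubleK. Qed.

Lemma levels_odd N up x i :
  levels N up x i.*2.+1 = if up then mid_level x i else N.+1 - mid_level x i.
Proof. by rewrite /levels /= odd_double /= uphalf_double. Qed.

(** Strictness at even positions comes from [gap_level_neq]; the clamping in [mid_level] keeps each
    odd entry between its neighbours. *)
Lemma vertex_levels k n up x : is_vertex k.+1 n x -> monotone_levels k up x ->
  is_vertex k (trunc_log 2 n).+1 (levels (trunc_log 2 n).+1 up x).
Proof.
move=> vx upx; set N := (trunc_log 2 n).+1.
have dpos i : i <= k -> 0 < gap_level x i <= N.
  by move=> ik; rewrite (gap_level_gt0 vx) // (gap_level_le vx).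
have ebd i : i < k ->
    minn (gap_level x i) (gap_level x i.+1) <= mid_level x i
    <= maxn (gap_level x i) (gap_level x i.+1).
  by move=> ik; apply: (mid_level_bounds vx).
have dup i : i < k -> if up then gap_level x i < gap_level x i.+1
    else gap_level x i.+1 < gap_level x i.
  move=> ik; have := upx i ik; have := @gap_level_neq _ _ _ vx i ik; rewrite /ascending.
  by clear upx; case: up => //; lia.
split.
- by rewrite -[0]/(0.*2) levels_even; have := dpos 0 isT; clear upx dup; case: up; lia.
- by rewrite levels_even; have := dpos k (leqnn k); clear upx dup; case: up; lia.
- move=> j jk; rewrite -[j]odd_double_half.
  have jk' : j./2 < k by lia.
  have := dup _ jk'; have := ebd _ jk'; have := dpos _ (ltnW jk'); have := dpos _ jk'.
  case: (odd j); rewrite ?add0n ?add1n -?doubleS ?levels_even ?levels_odd;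
    clear upx dup; case: up; lia.
- move=> i ik; rewrite -doubleS !levels_even.
  have := dup _ ik; have := dpos _ (ltnW ik); have := dpos _ ik.
  by clear upx dup; case: up; lia.
Qed.

Definition same_type k x y := [/\ forall i, i <= k -> left_heavy x i = left_heavy y i,
  forall i, i < k -> ascending x i = ascending y i,
  forall i, i < k -> mid_left x i = mid_left y i
  & forall i, i < k -> mid_right x i = mid_right y i].

Section Arc.
Variables (k n : nat) (x y : nat -> nat).
Hypotheses (vx : is_vertex k.+1 n x) (vy : is_vertex k.+1 n y).
Hypotheses (axy : is_arc k.+1 x y) (xy : same_type k x y).

Lemma same_type_levels i : i < k -> if ascending x i then
    [/\ gap_level x i < gap_level y i, gap_level y i <= gap_level x i.+1,
        gap_level x i.+1 < gap_level y i.+1, mid_level x i <= gap_level y i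
      & gap_level x i.+1 <= mid_level y i]
  else
    [/\ gap_level y i < gap_level x i, gap_level x i.+1 <= gap_level y i,
        gap_level y i.+1 < gap_level x i.+1, gap_level y i <= mid_level x i
      & mid_level y i <= gap_level x i.+1].
Proof.
case: xy => hl hu hL hR ik; apply: (arc_levels vx vy axy) => //;
  [exact/hl/ltnW|exact: hl|exact: hu|exact: hL|exact: hR].
Qed.

(** If the direction changed at gap [i.+1], the two pairs of gaps containing it would order
    [gap_level x i.+1] and [gap_level y i.+1] in opposite ways. *)
Lemma same_type_monotone : monotone_levels k (ascending x 0) x.
Proof.
elim=> [|i IH] // ik; rewrite -(IH (ltnW ik)).
have := same_type_levels ik; have := same_type_levels (ltnW ik).
by case: (ascending x i); case: (ascending x i.+1) => // -[_ _ h1 _ _] [h2 _ _ _ _]; lia.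
Qed.

Lemma arc_of_levels : 0 < k -> is_arc k (levels (trunc_log 2 n).+1 (ascending x 0) x)
  (levels (trunc_log 2 n).+1 (ascending x 0) y).
Proof.
move=> k0; set N := (trunc_log 2 n).+1.
have dpos i : i <= k -> 0 < gap_level x i <= N.
  by move=> ik; rewrite (gap_level_gt0 vx) // (gap_level_le vx).
have dposy i : i <= k -> 0 < gap_level y i <= N.
  by move=> ik; rewrite (gap_level_gt0 vy) // (gap_level_le vy).
have lev i (ik : i < k) := same_type_levels ik.
have upx := same_type_monotone.
split.
- move=> i; rewrite !levels_even; case: i => [|i] ik.
    have := lev 0 k0; have := dpos 0 isT; have := dposy 0 isT.
    by case: (ascending x 0) => ? ? []; lia.
  have := lev i ik; have := dpos i.+1 ik; have := dposy i.+1 ik; rewrite upx //.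
  by case: (ascending x 0) => ? ? []; lia.
- move=> i ik; rewrite -doubleS !levels_even; have := lev i ik; rewrite upx //.
  by case: (ascending x 0) => -[]; lia.
- move=> j jk; rewrite -[j]odd_double_half.
  have jk' : j./2 < k by lia.
  have := lev _ jk'; rewrite upx //.
  case: (odd j); rewrite ?add0n ?add1n -?doubleS ?levels_even ?levels_odd;
  by case: (ascending x 0) => -[]; lia.
Qed.

End Arc.

(* Besides being proper, a good colouring tells apart the two degenerate
   positions of the witness [x 1] in the first gap. *)
Definition good_coloring k n (T : eqType) (c : (nat -> nat) -> T) :=
  forall x y, is_vertex k n x -> is_vertex k n y ->
    (is_arc k x y -> c x != c y) /\
    (0 < k -> x 0 = x 1 -> y 1 = y 2 -> c x != c y).

(** * From a colouring for [k] gaps to one for [k.+1] gaps *)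

Section Code.
Variables (k n : nat) (T : finType) (c : (nat -> nat) -> T).
Hypothesis k0 : 0 < k.
Let N := (trunc_log 2 n).+1.
Hypothesis cP : good_coloring k N c.

Definition color_type : finType :=
  (bool * {ffun 'I_k -> bool} * {ffun 'I_k -> bool} * T +
   {ffun 'I_k.+1 -> bool * bool * bool * bool})%type.

(* The only bit omitted is [left_heavy x 1] if the levels increase, and
   [left_heavy x 0] if they decrease; by [mid_rightE] and [mid_leftE] it is
   determined by the position of [mid_level x 0]. *)
Definition color x : color_type :=
  let up := ascending x 0 in
  if [forall i : 'I_k, ascending x i == up] then
    inl (up,
         [ffun i : 'I_k => if up && (i == 0 :> nat) then left_heavy x 0
                           else left_heavy x i.+1],
         [ffun i : 'I_k => mid_left x i || mid_right x i],
         c (levels N up x))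
  else
    inr [ffun i : 'I_k.+1 =>
           (left_heavy x i, ascending x i, mid_left x i, mid_right x i)].

Lemma monotone_levelsP x : reflect (monotone_levels k (ascending x 0) x)
  [forall i : 'I_k, ascending x i == ascending x 0].
Proof.
apply: (iffP forallP) => [h i ik|h i]; first by move/eqP: (h (Ordinal ik)).
by apply/eqP/h.
Qed.

(** In the images, [mid_left x 0] makes entries 0 and 1 equal and [mid_right y 0] makes entries 1
    and 2 equal, so the second clause of [good_coloring] applies. *)
Lemma first_witness x y (up : bool) :
  is_vertex k.+1 n x -> is_vertex k.+1 n y ->
  monotone_levels k up x -> monotone_levels k up y ->
  mid_left x 0 -> mid_right y 0 -> c (levels N up x) != c (levels N up y).
Proof.
move=> vx vy ux uy /eqP xL /eqP yR.
have [_ ->] // := cP (vertex_levels vx ux) (vertex_levels vy uy).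
  by rewrite -[1]/(0.*2.+1) levels_odd -[0]/(0.*2) levels_even xL.
by rewrite -[1]/(0.*2.+1) levels_odd -[2]/(1.*2) levels_even yR.
Qed.

(** Equal values of [c] forbid one vertex at the left end and the other at the right end, so the
    disjunction alone fixes both bits. *)
Lemma same_first_witness x y (up : bool) :
  is_vertex k.+1 n x -> is_vertex k.+1 n y ->
  monotone_levels k up x -> monotone_levels k up y ->
  c (levels N up x) = c (levels N up y) ->
  mid_left x 0 || mid_right x 0 = mid_left y 0 || mid_right y 0 ->
  mid_left x 0 = mid_left y 0 /\ mid_right x 0 = mid_right y 0.
Proof.
move=> vx vy ux uy eqc.
have : ~~ (mid_left x 0 && mid_right y 0).
  by apply/andP => -[xL yR]; have := first_witness vx vy ux uy xL yR; rewrite eqc eqxx.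
have : ~~ (mid_left y 0 && mid_right x 0).
  by apply/andP => -[yL xR]; have := first_witness vy vx uy ux yL xR; rewrite eqc eqxx.
have : ~~ (mid_left x 0 && mid_right x 0).
  by apply/andP => -[xL]; rewrite (@mid_leftN_right _ _ _ vx 0 k0).
have : ~~ (mid_left y 0 && mid_right y 0).
  by apply/andP => -[yL]; rewrite (@mid_leftN_right _ _ _ vy 0 k0).
by case: (mid_left x 0) (mid_left y 0) (mid_right x 0) (mid_right y 0) => -[] [] [].
Qed.

Lemma color_same_type x y : is_vertex k.+1 n x -> is_vertex k.+1 n y ->
  color x = color y -> same_type k x y.
Proof.
move=> vx vy; rewrite /color.
case: monotone_levelsP => ux; case: monotone_levelsP => uy // []; last first.
  move=> /ffunP e.
  by split=> [i ik|i ik|i ik|i ik]; [have := e (Ordinal (ik : i < k.+1))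
    |have := e (Ordinal (ltnW ik : i < k.+1))
    |have := e (Ordinal (ltnW ik : i < k.+1))
    |have := e (Ordinal (ltnW ik : i < k.+1))]; rewrite !ffunE /= => -[].
move=> eup /ffunP eg /ffunP em; rewrite -eup in uy * => ec.
have [eL0 eR0] : mid_left x 0 = mid_left y 0 /\ mid_right x 0 = mid_right y 0.
  by apply: (same_first_witness vx vy ux uy ec); have := em (Ordinal k0); rewrite !ffunE.
have el0 : left_heavy x 0 = left_heavy y 0.
  have := eg (Ordinal k0); rewrite !ffunE -eup /= andbT; case: ifPn => // nup _.
  have nupy : ~~ ascending y 0 by rewrite -eup.
  by apply: negb_inj; rewrite -(@mid_leftE _ _ _ vx) // -(@mid_leftE _ _ _ vy).
have el i : i <= k -> left_heavy x i = left_heavy y i.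
  case: i => // -[|i] ik; last first.
    by have := eg (Ordinal ik); rewrite !ffunE /= !andbF.
  have := eg (Ordinal k0); rewrite !ffunE -eup /= andbT; case: ifPn => // up _.
  have upy : ascending y 0 by rewrite -eup.
  by rewrite -(@mid_rightE _ _ _ vx) // -(@mid_rightE _ _ _ vy).
split=> // [i ik|i ik|i ik]; first by rewrite ux // uy.
(* The direction and the side bits determine one of [mid_left], [mid_right]; as these exclude each
   other, their disjunction determines the other. *)
all: move: (em (Ordinal ik)); rewrite !ffunE /=.
all: move: (@mid_rightE _ _ _ vx i ik) (@mid_rightE _ _ _ vy i ik).
all: move: (@mid_leftE _ _ _ vx i ik) (@mid_leftE _ _ _ vy i ik).
all: move: (@mid_leftN_right _ _ _ vx i ik) (@mid_leftN_right _ _ _ vy i ik).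
all: rewrite (ux i ik) (uy i ik) -!(el i.+1 ik) -!(el i (ltnW ik)).
all: case: (ascending x 0) (mid_left x i) (mid_left y i) => -[] [] //.
all: case: (mid_right x i) (mid_right y i) => -[] //.
all: case: (left_heavy x i) (left_heavy x i.+1) => -[] //; intuition.
Qed.

(** An arc inside a colour class would force monotone levels, hence an arc between the images, whose
    colours [c] separates. *)
Lemma good_color : good_coloring k.+1 n color.
Proof.
move=> x y vx vy; split=> [axy|_ x01 y12]; apply/eqP => cxy.
  have xy := color_same_type vx vy cxy.
  have ux := same_type_monotone vx vy axy xy.
  have uy : monotone_levels k (ascending y 0) y.
    by case: xy => _ hu _ _ i ik; rewrite -!hu // ux.
  move: cxy; rewrite /color.
  move/monotone_levelsP: (ux) => ->; move/monotone_levelsP: (uy) => ->.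
  case=> up _ _; apply/eqP; rewrite -up; rewrite -up in uy.
  have [-> //] := cP (vertex_levels vx ux) (vertex_levels vy uy).
  exact: arc_of_levels.
(* An empty left half makes [x] not left-heavy in gap 0, while an empty right half makes [y]
   left-heavy there. *)
have [/(_ 0 isT) + _ _ _] := color_same_type vx vy cxy; have := @seg_level_neq _ _ _ vy 0 isT.
by rewrite /left_heavy /seg_level /= -x01 y12 !ruler_nn lt0n => ->.
Qed.

End Code.

(** * Base cases and induction *)

Lemma good_color0 n :
  good_coloring 0 n (fun x => inord (x 0) : 'I_n.+1).
Proof.
move=> x y [_ xn _ _] [_ yn _ _]; split=> // -[/(_ 0 isT) xy _ _].
apply/eqP => /(congr1 (@nat_of_ord _)); rewrite !inordK //.
by move=> eqxy; rewrite /= eqxy ltnn in xy.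
Qed.

(** Suppose level and side agree along an arc. If the side is left, ]x 0, x 2] and ]x 2, y 1] share
    this level; if it is right, ]x 1, y 0] and ]y 0, y 2] do. Both contradict [ruler_adjacent]. *)
Lemma good_color1 n :
  good_coloring 1 n
    (fun x => (inord (gap_level x 0).-1 : 'I_(trunc_log 2 n).+1, left_heavy x 0)).
Proof.
move=> x y vx vy; have nx := @seg_level_neq _ _ _ vx 0 isT.
have ny := @seg_level_neq _ _ _ vy 0 isT.
split=> [[axy ayx ajj]|_ x01 y12]; apply/eqP => -[].
  move=> /(congr1 (@nat_of_ord _)).
  have := @gap_level_gt0 _ _ _ vx 0 isT; have := @gap_level_gt0 _ _ _ vy 0 isT.
  have := @gap_level_le _ _ _ vx 0 isT; have := @gap_level_le _ _ _ vy 0 isT.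
  move=> lex ley gx gy; rewrite !inordK; [|lia|lia].
  move: nx ny gx gy {lex ley}.
  rewrite /left_heavy !(@gap_levelE _ _ _ vx) // !(@gap_levelE _ _ _ vy) //.
  rewrite /seg_level -[0.*2]/0.
  have y01 : y 0 <= y 1 by apply: (vertex_mono vy).
  have x2y1 : x 2 <= y 1 by apply: (ajj 1).
  have y0x2 : y 0 <= x 2 by apply: (ayx 0).
  have x1y0 : x 1 <= y 0 by apply: (ajj 0).
  have y12 : y 1 <= y 2 by apply: (vertex_mono vy).
  have x01 : x 0 <= x 1 by apply: (vertex_mono vx).
  have adj := @ruler_adjacent (x 0) (x 2) (y 1); rewrite x2y1 andbT in adj.
  have := adj (leq_trans x01 (leq_trans x1y0 y0x2)).
  have := @ruler_adjacent (x 1) (y 0) (y 2); rewrite x1y0 (leq_trans y01) //= => /(_ isT).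
  rewrite (@ruler_cat (x 0) (x 1) (x 2)) ?x01 ?(leq_trans x1y0) //.
  rewrite (@ruler_cat (y 0) (y 1) (y 2)) ?y01 //.
  rewrite (@ruler_cat (x 1) (y 0) (x 2)) ?x1y0 // (@ruler_cat (y 0) (x 2) (y 1)) ?y0x2 //.
  lia.
by move: nx ny; rewrite /left_heavy /seg_level /= -x01 y12 !ruler_nn lt0n => _ ->.
Qed.

Definition nlevels (n : nat) : nat := (trunc_log 2 n).+1.

Lemma good_coloring_exists k : exists K, forall n,
  exists (T : finType) (c : (nat -> nat) -> T),
    good_coloring k n c /\ #|T| <= 2 ^ (k ^ 2) * iter k nlevels n + K.
Proof.
elim: k => [|[|k] IH].
- exists 1 => n; exists 'I_n.+1, (fun x => inord (x 0)).
  by split; [exact: good_color0 | rewrite card_ord /= mul1n addn1].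
- exists 0 => n; do 2!eexists; split; first exact: good_color1.
  by rewrite card_prod card_ord card_bool addn0 mulnC.
have [K KP] := IH.
(* The new bits multiply the old constant; the second summand counts the codes of vertices with
   non-monotone levels. *)
exists (2 ^ (2 * k.+1).+1 * K + #|{ffun 'I_k.+2 -> bool * bool * bool * bool}|).
move=> n; have [T [c [cP cK]]] := KP (nlevels n).
do 2!eexists; split; first exact: (good_color (isT : 0 < k.+1) cP).
rewrite card_sum addnA leq_add2r !card_prod !card_ffun card_bool card_ord -!expnS -expnD.
have -> : k.+2 + k.+1 = (2 * k.+1).+1 by lia.
rewrite iterSr.
have -> : 2 ^ (k.+2 ^ 2) = 2 ^ (2 * k.+1).+1 * 2 ^ (k.+1 ^ 2).
  by rewrite -expnD; congr (2 ^ _); rewrite /=; lia.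
by rewrite -mulnA -mulnDr leq_mul2l cK orbT.
Qed.

(** * From sequences to the vertices of [G] *)

Section Graph.
Variables (k n : nat).

Definition entry (u : V k.+1 n) (j : nat) : nat := Defs.coord (val u) j.+1.

Lemma entry_vertex (u : V k.+1 n) : is_vertex k n (entry u).
Proof.
have /and3P[x1 /allP xm /allP xs] := valP u; split=> //; rewrite /entry.
- by rewrite /Defs.coord /= -ltnS ltn_ord.
- by move=> j jk; apply: (xm j.+1); rewrite mem_index_iota; lia.
- move=> i ik; have := xs i.+1; rewrite mem_index_iota.
  have -> : 2 * i.+1 - 1 = i.*2.+1 by lia.
  have -> : 2 * i.+1 + 1 = i.*2.+3 by lia.
  by apply; lia.
Qed.

Lemma entry_arc (u v : V k.+1 n) : Defs.arc u v -> is_arc k (entry u) (entry v).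
Proof.
case/and3P=> /allP a1 /allP a2 /allP a3; split.
- move=> i ik; have := a1 i.+1; rewrite mem_index_iota.
  have -> : 2 * i.+1 - 1 = i.*2.+1 by lia.
  by apply; lia.
- move=> i ik; have := a2 i.+1; rewrite mem_index_iota.
  have -> : 2 * i.+1 - 1 = i.*2.+1 by lia.
  have -> : 2 * i.+1 + 1 = i.*2.+3 by lia.
  by apply; lia.
- by move=> j jk; apply: (a3 j.+1); rewrite mem_index_iota; lia.
Qed.

Lemma chromatic_good_coloring (T : finType) (c : (nat -> nat) -> T) :
  good_coloring k n c -> chromatic_number (G k.+1 n) <= #|T|.
Proof.
move=> cP; rewrite /chromatic_number; case: ex_minnP => m _; apply.
apply/existsP; exists [ffun u => enum_rank (c (entry u))].
apply/forallP => u; apply/forallP => v; apply/implyP => /andP[_ uv].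
rewrite !ffunE (inj_eq enum_rank_inj).
by case/orP: uv => /entry_arc; [|rewrite eq_sym]; apply cP; apply: entry_vertex.
Qed.

End Graph.

(** * Asymptotics *)

Import Order.TTheory GRing.Theory Num.Theory.
Import numFieldNormedType.Exports.

Unset Implicit Arguments.

Local Open Scope classical_set_scope.
Local Open Scope ring_scope.

Lemma ln2_gt0 (R : realType) : 0 < ln (2 : R).
Proof. by rewrite ln_gt0 // ltr1n. Qed.

Lemma iter_log2_cvgy (R : realType) t :
  iter_log2 t (n%:R : R) @[n --> \oo] --> +oo.
Proof.
elim: t => [|t IH]; first exact: cvgr_idn.
apply/cvgryPge => A; move/cvgryPge/(_ (expR (A * ln 2))): IH.
apply: filterS => n; rewrite /iter_log2 iterS => lex.
rewrite /log2 ler_pdivlMr ?ln2_gt0 // -[leLHS]expRK ler_ln // posrE ?expR_gt0 //.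
exact: lt_le_trans (expR_gt0 _) lex.
Qed.

(** The slack 2 reproduces itself: [m <= x + 2 <= 2 * x] costs 1 in the logarithm, and the successor
    in [nlevels] costs another 1. *)
Lemma nlevels_log2 (R : realType) (m : nat) (x : R) : 2 <= x -> m%:R <= x + 2 ->
  (nlevels m)%:R <= log2 x + 2.
Proof.
move=> x2 mx; rewrite /nlevels -addn1 natrD.
suff : (trunc_log 2 m)%:R <= log2 x + 1 by lra.
have pow : (2 : R) ^+ trunc_log 2 m <= 2 * x.
  case: (posnP m) => [->|m0]; first by rewrite trunc_log0 expr0; lra.
  by rewrite -natrX (le_trans (y := m%:R)) ?ler_nat ?trunc_logP //; lra.
have x0 : 0 < x by lra.
have : ln ((2 : R) ^+ trunc_log 2 m) <= ln (2 * x).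
  by rewrite ler_ln // posrE ?exprn_gt0 // mulr_gt0.
rewrite lnXn // lnM ?posrE // -[_ *+ trunc_log 2 m]mulr_natl /log2 -ler_pdivlMr ?ln2_gt0 //.
by rewrite mulrDl divff ?lt0r_neq0 ?ln2_gt0 // addrC.
Qed.

Lemma iter_nlevels_log2 (R : realType) t : \forall n \near \oo,
  (iter t nlevels n)%:R <= iter_log2 t (n%:R : R) + 2.
Proof.
elim: t => [|t IH]; first by apply: nearW => n /=; lra.
have big : \forall n \near \oo, 2 <= iter_log2 t (n%:R : R).
  by move/cvgryPge: (iter_log2_cvgy R t); apply.
by apply: filterS2 IH big => n le ge2; apply: nlevels_log2.
Qed.

Theorem theorem4p3 (R : realType) (b : nat) (hb : (0 < b)%N) :
  exists eps : nat -> R,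
    eps @ \oo --> (0 : R) /\
    \forall n \near \oo,
      (chromatic_number (G b n))%:R <=
        (2 ^+ ((b - 1) ^ 2)%N + eps n) * iter_log2 (b - 1) n%:R.
Proof.
case: b hb => // k _; rewrite subn1 /=.
have [K KP] := good_coloring_exists k.
set C : R := 2 ^+ (k ^ 2)%N.
pose L n : R := iter_log2 k n%:R.
have L_gt0 : \forall n \near \oo, 0 < L n.
  by move/cvgryPgt: (iter_log2_cvgy R k); apply.
(* This choice makes the right-hand side equal to [C * (L n + 2) + K], the bound on the number of
   colours. *)
exists (fun n => (C * 2 + K%:R) * (L n)^-1); split.
  rewrite -(mulr0 (C * 2 + K%:R)); apply: cvgMl_tmp.
  by apply/gtr0_cvgV0 => //; exact: iter_log2_cvgy.
apply: filterS2 L_gt0 (iter_nlevels_log2 R k) => n Ln0 nlev.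
have [T [c [cP cK]]] := KP n.
have chi := leq_trans (chromatic_good_coloring cP) cK.
rewrite mulrDl mulfVK ?lt0r_neq0 //.
apply: le_trans (_ : C * (iter k nlevels n)%:R + K%:R <= _).
  by rewrite /C -natrX -natrM -natrD ler_nat.
by rewrite addrA lerD2r -mulrDr ler_wpM2l // exprn_ge0.
Qed.
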